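(* The time-one map $\phi=\phi_1$ of the continuous isotopy $\{\phi_t\}$ of $\mathbb R^{2n+1}$ constructed in the context is not Lipschitz continuous, and in particular, not $C^1$-smooth.
   Context: On $\mathbb R^{2n+1}$ use coordinates $(r_1,\dots,r_n,\theta_1,\dots,\theta_n,z)$, where $(r_i,\theta_i)$ are polar coordinates ($x_i=r_i\cos\theta_i$, $y_i=r_i\sin\theta_i$), write $r=\sqrt{r_1^2+\dots+r_n^2}$, and let $\alpha=dz+\frac12\sum_i r_i^2\,d\theta_i$. The contact vector field $X_H$ of a Hamiltonian $H$ is determined by $\alpha(X_H)=H$ and $\iota_{X_H}d\alpha=\frac{\partial H}{\partial z}\alpha-dH$; its flow is $\{\phi_H^t\}$. Construction. Let $0<a<2$. Let $\rho\colon(0,1]\to[0,\infty)$ be smooth, identically zero near $r=1$ and equal to $r^{-a}$ near $r=0$ (extended by $0$ for $r\ge1$). Let $\eta\colon\mathbb R\to[0,1]$ be smooth, compactly supported, with $\eta=1$ near $0$; $\rho$ and $\eta$ are chosen such that for some $u>0$, $\eta\big(z\pm(\frac12r^2\rho(r)+\int_r^1s\rho(s)\,ds)\big)=1$ for all $|z|\le u$ and all $r\ge0$ (values at $r=0$ are limits as $r\to0^+$, and the integral is $0$ for $r\ge1$). Choose smooth $\rho_j\colon[0,1]\to\mathbb R$, $j\ge1$, with $\rho_j(r)=\rho(r)$ for $r\ge\epsilon_j$, where $\epsilon_j\downarrow0$, and $0\le\rho_j\le\rho_k\le\rho$ for $k\ge j$, such that the compactly supported functions $H_j=\eta(z)\int_r^1s\rho_j(s)\,ds$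 (zero for $r\ge1$) are smooth on $\mathbb R^{2n+1}$. The flows $\{\phi_{H_j}^t\}$ converge uniformly as $j\to\infty$ to a compactly supported continuous isotopy $\{\phi_t\}_{0\le t\le1}$ of homeomorphisms of $\mathbb R^{2n+1}$; this is the isotopy in the claim. Lipschitz continuity is with respect to the Euclidean metric. *)

(* Defs.v *)
From HB Require Import structures.
From mathcomp Require Import all_boot all_order all_algebra.
From mathcomp Require Import all_classical all_reals all_analysis.

Set Implicit Arguments.
Unset Strict Implicit.
Unset Printing Implicit Defensive.

Import Order.TTheory GRing.Theory Num.Theory.
Import numFieldNormedType.Exports.

Local Open Scope classical_set_scope.
Local Open Scope ring_scope.

Section Smoothness.
Context {R : realType}.

(* [Ck_on U k f] is meant for open [U] and finite-dimensional [V], where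
   continuity of all directional derivatives is the usual C^1 condition. *)
Fixpoint Ck_on (V W : normedModType R) (U : set V) (k : nat) (f : V -> W)
    : Prop :=
  match k with
  | 0 => forall x, U x -> {for x, continuous f}
  | k'.+1 => (forall x, U x -> differentiable f x) /\
             (forall v, Ck_on U k' (fun x => 'D_v f x))
  end.

Definition smooth (V W : normedModType R) (U : set V) (f : V -> W) : Prop :=
  forall k, Ck_on U k f.

(* On a set that need not be open, smooth means smoothly extendable to an open
   neighbourhood. *)
Definition smooth_on (V W : normedModType R) (A : set V) (f : V -> W) : Prop :=
  exists U : set V, exists g : V -> W,
    [/\ open U, A `<=` U, smooth U g & forall x, A x -> f x = g x].

End Smoothness.

Section ContactSpace.
Context {R : realType} {n : nat}.

(* R^(2n+1), with coordinates ordered as (x_1..x_n, y_1..y_n, z). *)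
Local Notation E := 'rV[R]_(n + n + 1).

Definition xc (p : E) (i : 'I_n) : R := p ord0 (lshift 1 (lshift n i)).
Definition yc (p : E) (i : 'I_n) : R := p ord0 (lshift 1 (rshift n i)).
Definition zc (p : E) : R := p ord0 (rshift (n + n) ord0).

Definition rad (p : E) : R :=
  Num.sqrt (\sum_(i < n) (xc p i ^+ 2 + yc p i ^+ 2)).

(* [w p v] is the value at [p] of the 1-form [w] on the tangent vector [v]. *)
Definition ext_deriv (w : E -> E -> R) (p u v : E) : R :=
  'D_u (fun q => w q v) p - 'D_v (fun q => w q u) p.

(* In Cartesian coordinates r_i^2 dtheta_i = x_i dy_i - y_i dx_i. *)
Definition alpha (p v : E) : R :=
  zc v + 2^-1 * \sum_(i < n) (xc p i * yc v i - yc p i * xc v i).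

Definition ez : E := delta_mx ord0 (rshift (n + n) ord0).

Definition contact_field (H : E -> R) (X : E -> E) : Prop :=
  forall p, alpha p (X p) = H p /\
    forall v, ext_deriv alpha p (X p) v = 'd H p ez * alpha p v - 'd H p v.

Definition flow_of (X : E -> E) (phi : R -> E -> E) : Prop :=
  forall p, phi 0 p = p /\
    forall t : R, is_derive t 1 (fun s => phi s p) (X (phi t p)).

Definition contact_flow (H : E -> R) (phi : R -> E -> E) : Prop :=
  exists2 X, contact_field H X & flow_of X phi.

Definition homeomorphism (f : E -> E) : Prop :=
  continuous f /\
  exists g : E -> E, [/\ continuous g, cancel f g & cancel g f].

Definition compact_isotopy (phi : R -> E -> E) : Prop :=
  [/\ {within `[0, 1] `*` setT, continuous (fun q : R * E => phi q.1 q.2)},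
      forall p, phi 0 p = p,
      forall t, t \in `[0, 1] -> homeomorphism (phi t) &
      exists2 K : set E, compact K &
        forall t p, t \in `[0, 1] -> ~ K p -> phi t p = p].

Definition eucl_norm (p : E) : R := Num.sqrt (\sum_i p ord0 i ^+ 2).

Definition eucl_lipschitz (f : E -> E) : Prop :=
  exists L : R, forall p q, eucl_norm (f p - f q) <= L * eucl_norm (p - q).

End ContactSpace.

Section Hamiltonians.
Context {R : realType}.

(* The integral vanishes for r >= 1, which gives the extension by zero. *)
Definition tail_int (rho : R -> R) (r : R) : R :=
  \int[lebesgue_measure]_(s in `[r, 1]) (s * rho s).

Definition zshift_pos (rho : R -> R) (r : R) : R :=
  2^-1 * r ^+ 2 * rho r + tail_int rho r.

(* [rho] is only meaningful on r > 0, so the value at 0 is a right limit. *)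
Definition zshift (rho : R -> R) (r : R) : R :=
  if 0 < r then zshift_pos rho r else lim (zshift_pos rho s @[s --> 0^'+]).

Definition Ham {n : nat} (eta rho : R -> R) (p : 'rV[R]_(n + n + 1)) : R :=
  eta (zc p) * tail_int rho (rad p).

End Hamiltonians.

(* Main.v *)
(** Near a point where [eta = 1] the Hamiltonian is a function of the radius
    alone, so the contact field rotates every [(x_i, y_i)]-plane with angular
    velocity [- rho r] and moves [z] with the constant speed
    [r^2 rho r / 2 + int_r^1 s rho s ds]; the condition on [rho] and [eta] keeps
    trajectories starting in [z = 0] inside that region up to time one.  Hence on
    the [x_i]-axis the time-one map rotates by the angle [- r^-a] for small [r].
    At the radii [r_k] with [r_k^-a = (k + 1) pi] the images point alternately in
    opposite directions, so they are [r_k + r_(k+1)] apart, whereas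
    [r_(k+1) / r_k] tends to [1]: no Lipschitz constant can exist near [0]. *)
Require Import Defs.
From mathcomp Require Import all_boot all_order all_algebra.
From mathcomp Require Import all_classical all_reals all_analysis.
From mathcomp Require Import ring.

Import Order.TTheory GRing.Theory Num.Theory.
Import numFieldNormedType.Exports.

Local Open Scope classical_set_scope.
Local Open Scope ring_scope.

(** * Calculus on the line: directional derivatives, constant speed, continuation *)

Lemma is_derive_line (R : realType) (V W : normedModType R) (f : V -> W)
    (p v : V) (d : W) :
  is_derive p v f d <-> is_derive (0 : R) 1 (fun h : R => f (h *: v + p)) d.
Proof.
have e : 'D_v f p = 'D_1 (fun h : R => f (h *: v + p)) (0 : R).
  rewrite /derive; set g1 := fun h => h^-1 *: _; set g2 := fun h => h^-1 *: _.
  suff -> : g1 = g2 by [].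
  by apply/funext => h; rewrite /g1 /g2 /= addr0 scale0r add0r [_%:A]mulr1.
split=> -[df dE]; apply: DeriveDef; rewrite -?dE//.
  exact: (derivable1P _ _ _).1.
exact: (derivable1P _ _ _).2.
Qed.

Lemma is_derive_coord (R : realType) (V : normedModType R) (m n : nat)
    (M : V -> 'M[R]_(m, n)) (t v : V) (D : 'M[R]_(m, n)) i j :
  is_derive t v M D -> is_derive t v (fun s => M s i j) (D i j).
Proof.
case=> dM <-; apply: DeriveDef; first exact: (derivable_mxP _ _ _).1.
by rewrite derive_mx// mxE.
Qed.

Lemma derive1_const (R : realType) (f : R -> R) (c t : R) : 0 <= t ->
  (forall x, 0 <= x <= t -> is_derive x 1 f c) -> f t = f 0 + c * t.
Proof.
move=> t0 df.
have [||x _ ft] := @MVT_segment R f (fun=> c) 0 t t0.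
- by move=> x xt; apply: df; rewrite !(itvP xt).
- apply: derivable_within_continuous => x xt.
  by have [] := df x; rewrite ?(itvP xt).
by apply/eqP; rewrite addrC -subr_eq ft subr0.
Qed.

(* The first time at which [|f| >= d] cannot exist: [f] vanishes up to it. *)
Lemma zero_by_continuation (R : realType) (f : R -> R) (d : R) : 0 < d ->
  continuous f -> f 0 = 0 ->
  (forall t, 0 <= t <= 1 -> (forall s, 0 <= s <= t -> `|f s| < d) -> f t = 0) ->
  forall t, 0 <= t <= 1 -> f t = 0.
Proof.
move=> d0 cf f0 H t1 t1P.
apply: (H _ t1P) => s /andP[s0 st1]; rewrite ltNge; apply/negP => ds.
pose S := [set t : R | 0 <= t <= 1 /\ d <= `|f t|].
have Ss : S s by split=> //; rewrite s0 (le_trans st1)//; case/andP: t1P.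
have Slb : has_lbound S by exists 0 => t [/andP[]].
have Sinf : has_inf S by split=> //; exists s.
have i0 : 0 <= inf S by apply: lb_le_inf; [exists s|move=> t [/andP[]]].
have is_ : inf S <= s by exact: ge_inf.
have i1 : inf S <= 1 by rewrite (le_trans is_)// (le_trans st1)//; case/andP: t1P.
have lt_i t : 0 <= t -> t < inf S -> `|f t| < d.
  move=> t0 ti; rewrite ltNge; apply/negP => dt.
  have : inf S <= t by apply: ge_inf => //; split=> //; rewrite t0 (le_trans (ltW ti)).
  by rewrite leNgt ti.
have fi_lt t : 0 <= t -> t < inf S -> f t = 0.
  move=> t0 ti; apply: H => [|r /andP[r0 rt]]; first by rewrite t0 (le_trans (ltW ti)).
  by apply: lt_i => //; exact: le_lt_trans ti.
(* At the infimum itself the value is either the initial one or a left limit of zeros. *)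
have fi : `|f (inf S)| < d.
  have [i00|ipos] := leP (inf S) 0.
    by have -> : inf S = 0 by [apply/eqP; rewrite eq_le i00]; rewrite f0 normr0.
  have /cvgrPdist_lt /(_ _ d0) : f x @[x --> (inf S)^'-] --> f (inf S).
    exact/cvg_at_left_filter/cf.
  move=> fd; near (inf S)^'- => x.
  have fx0 : f x = 0 by apply: fi_lt; near: x; [exact: nbhs_left_ge|exact: nbhs_left_lt].
  rewrite -[f _]subr0 -fx0; near: x; exact: fd.
(* By continuity [|f| < d] on a ball around [inf S], yet [S] has points in that ball. *)
have /cvgrPdist_lt /(_ (d - `|f (inf S)|)) := cf (inf S).
rewrite subr_gt0 => /(_ fi) /nbhs_ballP[e /= e0 fe].
have [x Sx xie] : exists2 x, S x & x < inf S + e by exact: inf_adherent.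
have : ball (inf S) e x.
  by rewrite /ball/= distrC ger0_norm ?ltrBlDl// subr_ge0; exact: ge_inf.
move=> /fe /=; rewrite ltNge => /negP; apply.
have [_ dfx] := Sx; rewrite lerBlDr (le_trans dfx)//.
by rewrite -{1}(subrK (f (inf S)) (f x)) distrC ler_normD.
Unshelve. all: by end_near. Qed.

Lemma is_derive0_quadratic (R : realType) (A B C : R) :
  is_derive (0 : R) 1 (fun h => h ^+ 2 * A + h * B + C) B.
Proof.
apply/is_derive1_caratheodory; exists (fun z => z * A + B); split.
- by move=> z; ring.
- by apply: cvgD; [apply: cvgMr_tmp; exact: cvg_id|exact: cvg_cst].
- by rewrite mul0r add0r.
Qed.

(** * The exterior derivative of [alpha] and the differential of the Hamiltonian *)

Section ContactFields.
Context {R : realType} {n : nat}.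
Local Notation E := 'rV[R]_(n + n + 1).
(* [sesquilinear.rad] shadows the radius. *)
Local Notation rad := Defs.rad.

Definition mk_pt (f g : 'I_n -> R) (c : R) : E :=
  row_mx (row_mx (\row_i f i) (\row_i g i)) (\row_i c).

Lemma xc_mk_pt f g c i : xc (mk_pt f g c) i = f i.
Proof. by rewrite /xc /mk_pt !row_mxEl mxE. Qed.

Lemma yc_mk_pt f g c i : yc (mk_pt f g c) i = g i.
Proof. by rewrite /yc /mk_pt row_mxEl row_mxEr mxE. Qed.

Lemma zc_mk_pt f g c : zc (mk_pt f g c) = c.
Proof. by rewrite /zc /mk_pt row_mxEr mxE. Qed.

Definition mk_ptE := (xc_mk_pt, yc_mk_pt, zc_mk_pt).

Lemma xc_line h (v p : E) i : xc (h *: v + p) i = h * xc v i + xc p i.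
Proof. by rewrite /xc !mxE. Qed.

Lemma yc_line h (v p : E) i : yc (h *: v + p) i = h * yc v i + yc p i.
Proof. by rewrite /yc !mxE. Qed.

Lemma zc_line h (v p : E) : zc (h *: v + p) = h * zc v + zc p.
Proof. by rewrite /zc !mxE. Qed.

Definition lineE := (xc_line, yc_line, zc_line).

Lemma xc_ez i : xc (ez : E) i = 0.
Proof. by rewrite /xc /ez mxE eq_lrshift. Qed.

Lemma yc_ez i : yc (ez : E) i = 0.
Proof. by rewrite /yc /ez mxE eq_lrshift. Qed.

Definition hdot (p q : E) : R := \sum_(i < n) (xc p i * xc q i + yc p i * yc q i).

(** Generator of the simultaneous counterclockwise rotation of all [(x_i, y_i)]-planes. *)
Definition rot (p : E) : E := mk_pt (fun i => - yc p i) (xc p) 0.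

Lemma radE (p : E) : rad p = Num.sqrt (hdot p p).
Proof. by []. Qed.

Lemma hdot_ge0 (p : E) : 0 <= hdot p p.
Proof. by apply: sumr_ge0 => i _; rewrite addr_ge0// -expr2 sqr_ge0. Qed.

Lemma sqr_rad (p : E) : rad p ^+ 2 = hdot p p.
Proof. by rewrite radE sqr_sqrtr// hdot_ge0. Qed.

Lemma hdot_line h (v p : E) :
  hdot (h *: v + p) (h *: v + p) = h ^+ 2 * hdot v v + h * (2 * hdot p v) + hdot p p.
Proof.
rewrite /hdot !mulr_sumr -!big_split /=; apply: eq_bigr => i _.
by rewrite !lineE; ring.
Qed.

(** For a fixed vector, [alpha] is affine in the base point, so its derivatives do not depend on
    [p]. Antisymmetrising cancels the factor 1/2 and leaves the sum of the forms dx_i ∧ dy_i. *)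
Lemma ext_deriv_alpha (p u v : E) :
  ext_deriv alpha p u v = \sum_(i < n) (xc u i * yc v i - yc u i * xc v i).
Proof.
have D (s w : E) : is_derive p s (fun q => alpha q w)
    (2^-1 * \sum_(i < n) (xc s i * yc w i - yc s i * xc w i)).
  apply/is_derive_line; set c := 2^-1 * _.
  have -> : (fun h => alpha (h *: s + p) w) = (fun h => c * h + alpha p w).
    apply/funext => h; rewrite /alpha addrCA; congr (_ + _).
    rewrite /c -mulrA -mulrDr mulr_suml -big_split; congr (_ * _).
    apply: eq_bigr => i _; rewrite !lineE /=; ring.
  have -> : (fun h => c * h + alpha p w) = cst c * id + cst (alpha p w) by [].
  by apply: is_derive_eq; rewrite addr0 scaler0 addr0 [_ *: _]mulr1.
rewrite /ext_deriv !derive_val -mulrBr -sumrB mulr_sumr.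
by apply: eq_bigr => i _; field.
Qed.

Lemma diff_is_derive (H : E -> R) (p v : E) (d : R) :
  differentiable H p -> is_derive p v H d -> 'd H p v = d.
Proof. by move=> dH [_ <-]; rewrite deriveE. Qed.

Section HamDerivatives.
Variables (eta rho : R -> R) (p : E).
Hypothesis Hp : differentiable (Ham eta rho : E -> R) p.

(* Along [rot p] the Hamiltonian is an even function of the parameter. *)
Lemma dHam_rot : 'd (Ham eta rho : E -> R) p (rot p) = 0.
Proof.
pose G (h : R) := Ham eta rho (h *: rot p + p).
have : is_derive p (rot p) (Ham eta rho) ('d (Ham eta rho) p (rot p)).
  by rewrite -deriveE//; apply/derivableP/diff_derivable.
move=> /is_derive_line; rewrite -/G; move: ('d _ _ _) => d dG.
(* [rot p] is orthogonal to [p] and has no z-component, so only the square of [h] enters [G]. *)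
have GN : G = G \o -%R.
  have o : hdot p (rot p) = 0.
    by apply: big1 => i _; rewrite /rot !mk_ptE; ring.
  apply/funext => h; rewrite /G /Ham /= !lineE zc_mk_pt !mulr0 !radE !hdot_line.
  by rewrite o !mulr0 sqrrN.
have dGN : is_derive (0 : R) 1 (G \o -%R) (d * -1).
  by apply: is_derive1_comp; rewrite oppr0.
have [_ e1] := dG; have [_ e2] := dGN.
have : d = d * -1 by rewrite -{1}e1 -e2 -GN.
by move/eqP; rewrite mulrN1 -addr_eq0 -mulr2n mulrn_eq0 => /eqP.
Qed.

Hypothesis eta1 : \forall w \near zc p, eta w = 1.

Lemma near_Ham_line (v : E) :
  \forall h \near (0 : R), tail_int rho (rad (h *: v + p)) = Ham eta rho (h *: v + p).
Proof.
have : h * zc v + zc p @[h --> (0 : R)] --> 0 * zc v + zc p.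
  by apply: cvgD; [apply: cvgMr_tmp; exact: cvg_id|exact: cvg_cst].
rewrite mul0r add0r => /(_ _ eta1) e1.
near=> h; rewrite /Ham zc_line.
have -> : eta (h * zc v + zc p) = 1 by near: h; exact: e1.
by rewrite mul1r.
Unshelve. all: by end_near. Qed.

(** Where [eta] is locally 1, [Ham] is a function of the radius, which is constant along [ez]. *)
Lemma dHam_ez : 'd (Ham eta rho : E -> R) p ez = 0.
Proof.
apply: diff_is_derive => //; apply/is_derive_line.
apply: near_eq_is_derive (near_Ham_line ez) _.
have -> : (fun h => tail_int rho (rad (h *: ez + p))) = cst (tail_int rho (rad p)).
  apply/funext => h; rewrite !radE hdot_line.
  have e0 q : hdot q ez = 0.
    by apply: big1 => i _; rewrite xc_ez yc_ez !mulr0 addr0.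
  by rewrite !e0 !mulr0 !add0r.
exact: is_derive_cst.
Qed.

(** Chain rule through the square root of the quadratic [hdot_line]: the factor [rad p] from the
    tail integral cancels the reciprocal from the root. *)
Lemma dHam_radial (v : E) : 0 < rad p ->
  is_derive (rad p) 1 (tail_int rho) (- (rad p * rho (rad p))) ->
  'd (Ham eta rho : E -> R) p v = - (rho (rad p) * hdot p v).
Proof.
move=> r0 dF; apply: diff_is_derive => //; apply/is_derive_line.
apply: near_eq_is_derive (near_Ham_line v) _.
pose q := fun h : R => h ^+ 2 * hdot v v + h * (2 * hdot p v) + hdot p p.
have q0 : q 0 = hdot p p by rewrite /q expr0n/= !mul0r !add0r.
have -> : (fun h => tail_int rho (rad (h *: v + p))) = tail_int rho \o (Num.sqrt \o q).
  by apply/funext => h; rewrite radE hdot_line.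
have hp0 : 0 < hdot p p by rewrite -sqr_rad exprn_gt0.
have dq : is_derive (0 : R) 1 q (2 * hdot p v) by exact: is_derive0_quadratic.
have dsq : is_derive (0 : R) 1 (Num.sqrt \o q) ((2 * rad p)^-1 * (2 * hdot p v)).
  by apply: is_derive1_comp; rewrite q0 radE; exact: is_derive1_sqrt.
have -> : - (rho (rad p) * hdot p v) =
    - (rad p * rho (rad p)) * ((2 * rad p)^-1 * (2 * hdot p v)).
  by field; rewrite gt_eqF.
by apply: is_derive1_comp; rewrite /= q0 -radE.
Qed.

End HamDerivatives.
End ContactFields.

(** * Components of the contact field and its trajectories *)

Section Flow.
Context {R : realType} {n : nat}.
Local Notation E := 'rV[R]_(n + n + 1).
Local Notation rad := Defs.rad.

Lemma hdot_derive (g : R -> E) (t : R) (D : E) :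
  is_derive t 1 g D -> is_derive t 1 (fun s => hdot (g s) (g s)) (2 * hdot (g t) D).
Proof.
move=> dg.
pose h i : R -> R := (fun s => xc (g s) i) * (fun s => xc (g s) i)
                   + (fun s => yc (g s) i) * (fun s => yc (g s) i).
pose dh i : R := (xc (g t) i *: xc D i + xc (g t) i *: xc D i)
               + (yc (g t) i *: yc D i + yc (g t) i *: yc D i).
have hE : (fun s => hdot (g s) (g s)) = \sum_(i < n) h i.
  by apply/funext => s; rewrite fct_sumE.
have dhE : 2 * hdot (g t) D = \sum_(i < n) dh i.
  rewrite /hdot mulr_sumr; apply: eq_bigr => i _.
  by rewrite /dh /GRing.scale /=; ring.
have dhi i : is_derive t 1 (h i) (dh i).
  by apply: is_deriveD; apply: is_deriveM; exact: is_derive_coord.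
by rewrite hE dhE; exact: (@is_derive_sum _ _ _ n h t 1 dh dhi).
Qed.

Section Field.
Variables (eta rho : R -> R) (X : E -> E) (p : E).
Hypothesis HX : contact_field (Ham eta rho) X.
Hypothesis Hp : differentiable (Ham eta rho : E -> R) p.
Hypothesis eta1 : \forall w \near zc p, eta w = 1.

(** Since the z-derivative of the Hamiltonian vanishes here, the second contact equation becomes a
    Hamiltonian equation for the sum of dx_i ∧ dy_i. Testing it on suitable [v] yields the
    horizontal components. *)
Lemma contact_field_pairing (v : E) :
  \sum_(i < n) (xc (X p) i * yc v i - yc (X p) i * xc v i) =
  - 'd (Ham eta rho : E -> R) p v.
Proof.
have [_ /(_ v)] := HX p.
by rewrite ext_deriv_alpha => ->; rewrite dHam_ez// mul0r sub0r.
Qed.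

(** Pairing with [rot p] turns the symplectic form into [hdot]. As [dHam_rot] holds at every radius,
    this is available before the radius is known to be conserved. *)
Lemma contact_field_tangent : hdot p (X p) = 0.
Proof.
have := contact_field_pairing (rot p); rewrite dHam_rot// oppr0 => <-.
by apply: eq_bigr => i _; rewrite /rot !mk_ptE; ring.
Qed.

Hypothesis r0 : 0 < rad p.
Hypothesis dF : is_derive (rad p) 1 (tail_int rho) (- (rad p * rho (rad p))).

Lemma contact_field_x i : xc (X p) i = rho (rad p) * yc p i.
Proof.
(* The unit vector in direction y_i isolates the x_i-component of the field. *)
pose v : E := mk_pt (fun=> 0) (fun j => (j == i)%:R) 0.
have := contact_field_pairing v; rewrite dHam_radial// opprK /hdot.
rewrite (bigD1 i)//= big1 => [|j ji]; last by rewrite !mk_ptE (negbTE ji) !mulr0 subr0.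
rewrite [in RHS](bigD1 i)//= [in RHS]big1 => [|j ji].
  by rewrite !mk_ptE eqxx !mulr1 !mulr0 subr0 add0r !addr0.
by rewrite !mk_ptE (negbTE ji) !mulr0 addr0.
Qed.

Lemma contact_field_y i : yc (X p) i = - (rho (rad p) * xc p i).
Proof.
pose v : E := mk_pt (fun j => (j == i)%:R) (fun=> 0) 0.
have := contact_field_pairing v; rewrite dHam_radial// opprK /hdot.
rewrite (bigD1 i)//= big1 => [|j ji]; last by rewrite !mk_ptE (negbTE ji) !mulr0 subr0.
rewrite [in RHS](bigD1 i)//= [in RHS]big1 => [|j ji].
  by rewrite !mk_ptE eqxx !mulr1 !mulr0 sub0r !addr0 => <-; rewrite opprK.
by rewrite !mk_ptE (negbTE ji) !mulr0 addr0.
Qed.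

(** Solving [alpha p (X p) = H p] for the z-component: the rotation contributes
    [- rho r * r ^+ 2 / 2] to the left side. *)
Lemma contact_field_z : zc (X p) = zshift_pos rho (rad p).
Proof.
have [+ _] := HX p.
rewrite /alpha /Ham (nbhs_singleton eta1) mul1r.
rewrite (_ : \sum_(i < n) _ = - (rho (rad p) * hdot p p)).
  by rewrite -sqr_rad /zshift_pos => <-; ring.
rewrite /hdot mulr_sumr -sumrN; apply: eq_bigr => i _.
by rewrite contact_field_x contact_field_y; ring.
Qed.

End Field.

Section Trajectory.
Variables (eta rho : R -> R) (phi : R -> E -> E) (p0 : E) (u : R).
Hypothesis Hd : forall p, differentiable (Ham eta rho : E -> R) p.
Hypothesis Hphi : contact_flow (Ham eta rho) phi.
Hypothesis z0 : zc p0 = 0.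
Hypothesis r0 : 0 < rad p0.
Hypothesis dF : is_derive (rad p0) 1 (tail_int rho) (- (rad p0 * rho (rad p0))).
Hypothesis u0 : 0 < u.
Local Notation Z := (zshift_pos rho (rad p0)).
Hypothesis eta1 : forall t, 0 <= t <= 1 ->
  forall w, `|w - t * Z| <= u -> eta w = 1.

(** [eta1] supplies a closed tube of radius [u] about the predicted height [t * Z]; the strict
    inequality leaves room for a neighbourhood. *)
Lemma eta_near_trajectory (t z : R) : 0 <= t <= 1 -> `|z - t * Z| < u ->
  \forall w \near z, eta w = 1.
Proof.
move=> t01 zu; near=> w; apply: (eta1 t t01).
have -> : w - t * Z = (z - t * Z) - (z - w) by ring.
rewrite (le_trans (ler_normB _ _))// -lerBrDl ltW//; near: w.
have := @cvg_id _ (nbhs z); move=> /cvgrPdist_lt; apply.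
by rewrite subr_gt0.
Unshelve. all: by end_near. Qed.

(** While the height stays in the tube the field is tangent to the level sets of [rad], so the
    squared radius has zero derivative. *)
Lemma trajectory_rad (t : R) : 0 <= t <= 1 ->
  (forall s, 0 <= s <= t -> `|zc (phi s p0) - s * Z| < u) ->
  forall s, 0 <= s <= t -> rad (phi s p0) = rad p0.
Proof.
move=> /andP[t0 t1] hz s /andP[s0 st].
have [X HX fl] := Hphi; have [phi0 dphi] := fl p0.
have : hdot (phi s p0) (phi s p0) = hdot p0 p0.
  suff : hdot (phi s p0) (phi s p0) = hdot (phi 0 p0) (phi 0 p0) + 0 * s.
    by rewrite phi0 mul0r addr0.
  apply: (@derive1_const _ (fun s => hdot (phi s p0) (phi s p0))) => // x /andP[x0 xs]; have xt := le_trans xs st.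
  have := @hdot_derive (fun s => phi s p0) x _ (dphi x).
  rewrite (@contact_field_tangent eta rho)// ?mulr0//.
  by apply: (eta_near_trajectory x); [rewrite x0 (le_trans xt)|apply: hz; rewrite x0].
by rewrite !radE => ->.
Qed.

(** Bootstrap: inside the tube the radius is conserved, so [dF] applies along the path and the
    vertical speed is exactly [Z]. The deviation from [t * Z] is then zero, and continuation carries
    this up to time one. *)
Lemma trajectory_z (t : R) : 0 <= t <= 1 -> zc (phi t p0) - t * Z = 0.
Proof.
have [X HX fl] := Hphi; have [phi0 dphi] := fl p0.
apply: (zero_by_continuation _ (fun t => zc (phi t p0) - t * Z) u u0).
- move=> s; apply: cvgB; last by apply: cvgMr_tmp; exact: cvg_id.
  have [] := @is_derive_coord _ _ _ _ _ _ _ _ ord0 (rshift (n + n) ord0) (dphi s).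
  by move=> /derivable1_diffP /differentiable_continuous.
- by rewrite phi0 z0 mul0r subr0.
move=> {}t t01 hz; have /andP[t0 t1] := t01.
suff : zc (phi t p0) = zc (phi 0 p0) + Z * t.
  by rewrite phi0 z0 add0r mulrC => ->; rewrite subrr.
apply: (@derive1_const _ (fun s => zc (phi s p0))) => // x xt; have /andP[x0 x1] := xt.
have rx := trajectory_rad t t01 hz x xt.
have ex : \forall w \near zc (phi x p0), eta w = 1.
  by apply: (eta_near_trajectory x); [rewrite x0 (le_trans x1)|exact: hz].
have <- : zc (X (phi x p0)) = Z.
  by rewrite -rx; apply: (@contact_field_z eta rho) => //; rewrite rx.
exact: is_derive_coord.
Qed.

(* The flow rotates each [(x_i, y_i)]-plane clockwise with angular velocity
   [rho r]; rotating back gives a constant. *)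
Lemma trajectory_x i :
  xc (phi 1 p0) i * cos (rho (rad p0)) - yc (phi 1 p0) i * sin (rho (rad p0)) =
  xc p0 i.
Proof.
have [X HX fl] := Hphi; have [phi0 dphi] := fl p0.
set w := rho (rad p0).
pose f : R -> R := (fun s => xc (phi s p0) i) * (cos \o ( *%R w)) -
          (fun s => yc (phi s p0) i) * (sin \o ( *%R w)).
have small s : 0 <= s <= 1 -> `|zc (phi s p0) - s * Z| < u.
  by move=> s01; rewrite trajectory_z// normr0.
have f1 : f 1 = f 0 + 0 * 1.
  apply: derive1_const => // x x01.
  have i01 : 0 <= (1 : R) <= 1 by rewrite ler01 lexx.
  have rx := trajectory_rad 1 i01 small x x01.
  have ex := eta_near_trajectory x (zc (phi x p0)) x01 (small x x01).
  have dx : is_derive x 1 (fun s => xc (phi s p0) i) (w * yc (phi x p0) i).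
    have <- : xc (X (phi x p0)) i = w * yc (phi x p0) i.
      by rewrite /w -rx; apply: (contact_field_x eta rho) => //; rewrite rx.
    exact: is_derive_coord.
  have dy : is_derive x 1 (fun s => yc (phi s p0) i) (- (w * xc (phi x p0) i)).
    have <- : yc (X (phi x p0)) i = - (w * xc (phi x p0) i).
      by rewrite /w -rx; apply: (contact_field_y eta rho) => //; rewrite rx.
    exact: is_derive_coord.
  have dw : is_derive x 1 ( *%R w) w.
    by apply/is_derive1_caratheodory; exists (fun=> w); split=> // [z|]; [ring|exact: cvg_cst].
  have dc : is_derive x 1 (cos \o ( *%R w)) (- sin (w * x) * w) by exact: is_derive1_comp.
  have ds : is_derive x 1 (sin \o ( *%R w)) (cos (w * x) * w) by exact: is_derive1_comp.
  have := is_deriveB (is_deriveM dx dc) (is_deriveM dy ds).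
  congr (is_derive _ _ _ _); rewrite /GRing.scale /=; ring.
move: f1; rewrite mul0r addr0 /f !fctE /= mulr1 mulr0 cos0 sin0 phi0 mulr1 mulr0.
by rewrite subr0.
Qed.

End Trajectory.
End Flow.

(** * Continuity of the profiles, and the tail integral *)

Lemma smooth_on_within_continuous (R : realType) (V W : normedModType R)
    (A : set V) (f : V -> W) : smooth_on A f -> {within A, continuous f}.
Proof.
move=> [U [g [_ AU gs fg]]].
apply: (@subspace_eq_continuous _ _ _ g).
  by move=> x; rewrite inE => /fg /esym.
apply: continuous_in_subspaceT => x; rewrite inE => Ax.
exact: (gs 0%N) (AU _ Ax).
Qed.

Section TailIntegral.
Context {R : realType}.
Local Notation mu := (@lebesgue_measure R).
Variable rho : R -> R.

Section ContinuousProfile.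
Hypothesis crho : {within `[0, 1], continuous rho}.

Local Notation f := (fun s => s * rho s).

Let cf : {within `[0, 1], continuous f}.
Proof.
move=> x; apply: cvgM; last exact: crho.
exact: (continuous_subspaceT (fun y => cvg_id)).
Qed.

Let intf : mu.-integrable `[0, 1] (EFin \o f).
Proof. by apply: continuous_compact_integrable => //; exact: segment_compact. Qed.

(** Moves the variable from the lower to the upper limit, the form in which the fundamental theorem
    of calculus applies. *)
Let tail_intE (r : R) : 0 <= r <= 1 ->
  tail_int rho r =
    \int[mu]_(s in `[0, 1]) (s * rho s) - \int[mu]_(s in `[0, r]) (s * rho s).
Proof.
move=> /andP[r0 r1]; rewrite Rintegral_itvB ?bnd_simp//.
rewrite /tail_int Rintegral_itv_obnd_cbnd//.
by apply: integrableS intf => //; apply: subset_itvr; rewrite bnd_simp.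
Qed.

Lemma tail_int_is_derive (r : R) : 0 < r < 1 ->
  is_derive r 1 (tail_int rho) (- (r * rho r)).
Proof.
move=> /andP[r0 r1].
have cr : {for r, continuous (fun s : R => s * rho s)}.
  have /(continuous_within_itvP _ ltr01)[+ _ _] := cf.
  by apply; rewrite in_itv/= r0.
have [dF dFE] := continuous_FTC1_closed r1 intf r0 cr.
pose c := \int[mu]_(s in `[(0 : R), 1]) (s * rho s).
pose F x := \int[mu]_(s in `[(0 : R), x]) (s * rho s).
apply: (@near_eq_is_derive _ _ _ (cst c - F)).
  near=> x; rewrite tail_intE//; apply/andP; split.
    by apply/ltW; near: x; exact: lt_nbhsr.
  by apply/ltW; near: x; exact: lt_nbhsl.
have {}dF : is_derive r 1 F (r * rho r) by apply: DeriveDef; rewrite -?derive1E.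
by have := is_deriveB (is_derive_cst c r 1) dF; rewrite sub0r.
Unshelve. all: by end_near. Qed.

Lemma zshift_pos_continuous : {within `[0, 1], continuous (zshift_pos rho)}.
Proof.
have ct : {within `[0, 1], continuous (tail_int rho)}.
  apply: (@subspace_eq_continuous _ _ _ (fun r =>
    \int[mu]_(s in `[(0 : R), 1]) (s * rho s)
    - \int[mu]_(s in `[(0 : R), r]) (s * rho s))).
    by move=> x; rewrite inE/= in_itv/= => x01; exact/esym/tail_intE.
  move=> x; apply: cvgB; first exact: cvg_cst.
  exact: (@parameterized_integral_continuous R 0 1 _ ler01 intf x).
move=> x; apply: cvgD; last exact: ct.
apply: cvgM; last exact: crho.
have : {within `[0, 1], continuous (fun r : R => 2^-1 * r ^+ 2)}.
  apply: continuous_subspaceT => y.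
  by apply: cvgMl_tmp; exact: exprn_continuous.
exact.
Qed.

(** The shift vanishes at radius 1, so by the intermediate value theorem every fraction of the shift
    at [r] is the full shift at some larger radius. A condition on full shifts at all radii thus
    controls intermediate times too. *)
Lemma zshift_pos_scaled (r t : R) : rho 1 = 0 -> 0 <= r <= 1 -> 0 <= t <= 1 ->
  exists2 c, r <= c <= 1 & zshift_pos rho c = t * zshift_pos rho r.
Proof.
move=> rho1 /andP[r0 r1] /andP[t0 t1].
have Z1 : zshift_pos rho 1 = 0.
  by rewrite /zshift_pos rho1 mulr0 add0r /tail_int set_itv1 Rintegral_set1.
have cZ : {within `[r, 1], continuous (zshift_pos rho)}.
  by apply: continuous_subspaceW zshift_pos_continuous; apply: subset_itvr; rewrite bnd_simp.
have [|c] := @IVT _ _ r 1 (t * zshift_pos rho r) r1 cZ.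
  rewrite Z1 ge_min le_max; case: (leP 0 (zshift_pos rho r)) => Zr.
    by rewrite ler_piMl// mulr_ge0// orbT.
  by rewrite ler_niMl ?(ltW Zr)// mulr_ge0_le0 ?(ltW Zr)// orbT.
by rewrite in_itv/=; exists c.
Qed.

End ContinuousProfile.

Lemma eq_tail_int (rho' : R -> R) (r : R) :
  (forall s, r <= s <= 1 -> rho' s = rho s) -> tail_int rho' r = tail_int rho r.
Proof.
by move=> e; apply: eq_Rintegral => s; rewrite inE/= in_itv/= => /e ->.
Qed.

Lemma eq_zshift_pos (rho' : R -> R) (r : R) : r <= 1 ->
  (forall s, r <= s <= 1 -> rho' s = rho s) -> zshift_pos rho' r = zshift_pos rho r.
Proof. by move=> r1 e; rewrite /zshift_pos e ?lexx// (eq_tail_int _ _ e). Qed.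

End TailIntegral.

(** * The radii at which the rotation angle is a multiple of pi *)

Section OppositeRadii.
Context {R : realType}.
Variable a : R.
Hypothesis a0 : 0 < a.

(** The solution of r^-a = (k + 1) pi; starting at [k.+1] keeps the base of the power positive. *)
Definition opp_rad (k : nat) : R := (k.+1%:R * pi) `^ (- a^-1).

Let kpi_gt0 k : 0 < k.+1%:R * pi :> R.
Proof. by rewrite mulr_gt0 ?ltr0n ?pi_gt0. Qed.

Lemma opp_rad_gt0 k : 0 < opp_rad k.
Proof. by rewrite powR_gt0 ?kpi_gt0. Qed.

Lemma opp_rad_powR k : opp_rad k `^ (- a) = k.+1%:R * pi.
Proof.
rewrite /opp_rad -powRrM mulrNN mulVf ?gt_eqF// powRr1//.
by rewrite ltW ?kpi_gt0.
Qed.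

Lemma opp_rad_lt k : opp_rad k.+1 < opp_rad k.
Proof.
rewrite /opp_rad !powRN ltf_pV2 ?posrE ?powR_gt0//.
apply: gt0_ltr_powR; rewrite ?invr_gt0 ?nnegrE ?(ltW (kpi_gt0 _))//.
by rewrite ltr_pM2r ?pi_gt0// ltr_nat.
Qed.

Lemma opp_rad_small (e : R) : 0 < e ->
  \forall k \near \oo, forall m, (k <= m)%N -> opp_rad m < e.
Proof.
move=> e0; near=> k => m km.
rewrite ltNge; apply/negP => er.
have : e `^ a <= opp_rad m `^ a.
  by apply: ge0_ler_powR => //; rewrite ?nnegrE ltW// opp_rad_gt0.
rewrite -[X in _ `^ X]opprK -[X in _ <= _ `^ X]opprK !(powRN _ (- a)).
rewrite opp_rad_powR lef_pV2 ?posrE ?kpi_gt0 ?powR_gt0//.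
apply/negP; rewrite -ltNge -ltr_pdivrMr ?pi_gt0//.
apply: (@lt_le_trans _ _ k%:R); last by rewrite ler_nat leqW.
near: k; exact: nbhs_infty_gtr.
Unshelve. all: by end_near. Qed.

(** The ratio is (1 + 1/(k+1))^(-1/a), and the power function is continuous at 1. *)
Lemma opp_rad_ratio : opp_rad k.+1 / opp_rad k @[k --> \oo] --> (1 : R).
Proof.
have -> : (fun k => opp_rad k.+1 / opp_rad k) =
    (fun k => (1 + harmonic k) `^ (- a^-1)).
  apply/funext => k; rewrite /opp_rad -powRN opprK.
  have -> : k.+2%:R * pi = (1 + harmonic k) * (k.+1%:R * pi) :> R.
    by rewrite /harmonic/= -[k.+2]addn1 natrD; field.
  have h0 : 0 <= 1 + harmonic k :> R by rewrite addr_ge0// ltW// harmonic_gt0.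
  rewrite (powRM _ h0 (ltW (kpi_gt0 k))) -mulrA -powRD ?addNr ?powRr0 ?mulr1//.
  by apply/implyP => _; rewrite gt_eqF.
have c1 : {for (1 : R), continuous (fun x => x `^ (- a^-1))}.
  apply/differentiable_continuous/derivable1_diffP.
  by have [] := is_derive1_powR (- a^-1) (@ltr01 R).
have : (1 + harmonic k) @[k --> \oo] --> (1 + 0 : R).
  by apply: cvgD; [exact: cvg_cst|exact: cvg_harmonic].
rewrite addr0 => h1.
have e1 : 1 `^ (- a^-1) = 1 :> R by rewrite powR1.
by rewrite -[X in _ --> X]e1; exact: (cvg_comp _ _ h1 c1).
Qed.

(** After division by [opp_rad k] the left side tends to 0, while the right side stays above 1. *)
Lemma opp_rad_not_lipschitz (L : R) :
  \forall k \near \oo, L * (opp_rad k - opp_rad k.+1) < opp_rad k + opp_rad k.+1.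
Proof.
have : L * (1 - opp_rad k.+1 / opp_rad k) @[k --> \oo] --> L * (1 - 1).
  by apply: cvgMl_tmp; apply: cvgB; [exact: cvg_cst|exact: opp_rad_ratio].
rewrite subrr mulr0 => /cvgrPdist_lt /(_ _ ltr01) h.
near=> k.
have r0 := opp_rad_gt0 k.
have : `|0 - L * (1 - opp_rad k.+1 / opp_rad k)| < 1 by near: k; exact: h.
rewrite sub0r normrN => /(le_lt_trans (ler_norm _)) h1.
have -> : L * (opp_rad k - opp_rad k.+1) =
    L * (1 - opp_rad k.+1 / opp_rad k) * opp_rad k.
  by field; rewrite gt_eqF.
apply: (@lt_trans _ _ (1 * opp_rad k)); first by rewrite ltr_pM2r.
by rewrite mul1r ltrDl opp_rad_gt0.
Unshelve. all: by end_near. Qed.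

End OppositeRadii.

(** * Maps that alternate in sign along the x_i-axis *)

Section Axis.
Context {R : realType} {n : nat}.
Local Notation E := 'rV[R]_(n + n + 1).
Local Notation rad := Defs.rad.

Definition xdir (i : 'I_n) : E := delta_mx ord0 (lshift 1 (lshift n i)).

Lemma xc_xdir i j : xc (xdir i) j = (j == i)%:R.
Proof. by rewrite /xc mxE !eq_lshift eqxx. Qed.

Lemma yc_xdir i j : yc (xdir i) j = 0.
Proof. by rewrite /yc mxE eq_lshift eq_rlshift andbF. Qed.

Lemma zc_xdir i : zc (xdir i) = 0.
Proof. by rewrite /zc mxE eq_rlshift andbF. Qed.

Lemma rad_axis i (r : R) : 0 <= r -> rad (r *: xdir i) = r.
Proof.
move=> r0; rewrite radE -[r *: _]addr0 hdot_line.
have h0 q : hdot (0 : E) q = 0.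
  by apply: big1 => j _; rewrite /xc /yc !mxE !mul0r addr0.
have -> : hdot (xdir i) (xdir i) = 1.
  rewrite /hdot (bigD1 i)//= big1 => [|j ji].
    by rewrite xc_xdir yc_xdir eqxx mulr1 mulr0 !addr0.
  by rewrite xc_xdir yc_xdir (negbTE ji) !mulr0 addr0.
by rewrite !h0 !mulr0 !addr0 mulr1 sqrtr_sqr ger0_norm.
Qed.

Lemma xcZ (r : R) (p : E) i : xc (r *: p) i = r * xc p i.
Proof. by rewrite /xc mxE. Qed.

Lemma zcZ (r : R) (p : E) : zc (r *: p) = r * zc p.
Proof. by rewrite /zc mxE. Qed.

Lemma eucl_norm_axis i (r : R) : eucl_norm (r *: xdir i) = `|r|.
Proof.
rewrite /eucl_norm (bigD1 (lshift 1 (lshift n i)))//= big1 => [|j ji].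
  by rewrite /xdir !mxE !eqxx mulr1 addr0 sqrtr_sqr.
by rewrite /xdir !mxE (negbTE ji) mulr0 expr0n.
Qed.

Lemma le_xc_eucl_norm (p : E) i : `|xc p i| <= eucl_norm p.
Proof.
rewrite /eucl_norm -sqrtr_sqr ler_sqrt ?sumr_ge0// => [|j _]; last exact: sqr_ge0.
rewrite (bigD1 (lshift 1 (lshift n i)))//= lerDl.
by apply: sumr_ge0 => j _; exact: sqr_ge0.
Qed.

Section AlternatingMap.
Variables (f : E -> E) (a : R) (i : 'I_n) (K : nat).
Hypothesis a0 : 0 < a.
Hypothesis fK : forall k, (K <= k)%N ->
  xc (f (opp_rad a k *: xdir i)) i = (-1) ^+ k.+1 * opp_rad a k.

Local Notation g := (fun s : R => xc (f (s *: xdir i)) i).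

(** The signs at [k] and [k.+1] are opposite, so the two values differ by the sum of the radii in
    absolute value. *)
Lemma alternating_not_lipschitz (L : R) : \forall k \near \oo,
  L * (opp_rad a k - opp_rad a k.+1) < `|g (opp_rad a k) - g (opp_rad a k.+1)|.
Proof.
near=> k.
have Kk : (K <= k)%N by near: k; exact: nbhs_infty_ge.
rewrite !fK ?(leqW Kk)// (exprS _ k.+1) mulN1r mulNr opprK.
rewrite -mulrDr normrMsign ger0_norm; last by rewrite addr_ge0 ?ltW ?opp_rad_gt0.
near: k; exact: opp_rad_not_lipschitz.
Unshelve. all: by end_near. Qed.

Lemma alternating_not_eucl_lipschitz : ~ eucl_lipschitz f.
Proof.
move=> [L fL]; have [k _ /(_ k (leqnn k))] := alternating_not_lipschitz L.
apply/negP; rewrite -leNgt.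
have -> : g (opp_rad a k) - g (opp_rad a k.+1) =
    xc (f (opp_rad a k *: xdir i) - f (opp_rad a k.+1 *: xdir i)) i.
  by rewrite /xc !mxE.
apply: (le_trans (le_xc_eucl_norm _ i)); apply: (le_trans (fL _ _)).
by rewrite -scalerBl eucl_norm_axis ger0_norm// subr_ge0 ltW// opp_rad_lt.
Qed.

(** A continuous derivative would be bounded near the origin, and the mean value theorem on the axis
    would give a Lipschitz bound for all small radii, which the alternation excludes. *)
Lemma alternating_not_C1 : ~ Ck_on setT 1 f.
Proof.
move=> [df /(_ (xdir i)) cf].
pose c s := xc ('D_(xdir i) f (s *: xdir i)) i.
have dg (s : R) : is_derive s 1 g (c s).
  apply/is_derive_line.
  have -> : (fun h : R => g (h *: 1 + s)) =
      (fun h : R => xc (f (h *: xdir i + s *: xdir i)) i).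
    by apply/funext => h; rewrite -scalerDl [_%:A]mulr1.
  apply: is_derive_coord; apply: (is_derive_line _ _ _ f _ _ _).1.
  exact/derivableP/diff_derivable/df.
have cc : {for (0 : R), continuous c}.
  apply: (@continuous_comp _ _ _ (fun s : R => 'D_(xdir i) f (s *: xdir i)) (fun p => xc p i)).
    apply: (@continuous_comp _ _ _ (fun s : R => s *: xdir i) ('D_(xdir i) f)).
      exact: scalel_continuous.
    exact: cf.
  exact: coord_continuous.
(* The local bound [|c 0| + 1] takes the place of the Lipschitz constant. *)
have [d /= d0 dL] : exists2 d : R, 0 < d & forall s, `|s| < d -> `|c s| <= `|c 0| + 1.
  move: cc => /cvgrPdist_lt /(_ _ ltr01) /nbhs_ballP [d /= d0 dc]; exists d => // s sd.
  have : ball (0 : R) d s by rewrite /ball/= sub0r normrN.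
  move=> /dc /= cs; rewrite -[c s](subKr (c 0)).
  by rewrite (le_trans (ler_normB _ _))// lerD2l ltW.
near \oo => k.
have rd m : (k <= m)%N -> opp_rad a m < d.
  by move: m; near: k; exact: opp_rad_small.
have : (`|c 0| + 1) * (opp_rad a k - opp_rad a k.+1) <
    `|g (opp_rad a k) - g (opp_rad a k.+1)|.
  by near: k; exact: alternating_not_lipschitz.
apply/negP; rewrite -leNgt.
have rk := ltW (opp_rad_lt a a0 k).
have [|x xr ->] := @MVT_segment R g c (opp_rad a k.+1) (opp_rad a k) rk.
  by apply: derivable_within_continuous => x _; have [] := dg x.
rewrite normrM [X in _ * X]ger0_norm; last by rewrite subr_ge0 ltW// opp_rad_lt.
rewrite ler_wpM2r//; first by rewrite subr_ge0 ltW// opp_rad_lt.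
have x0 : 0 <= x by rewrite (le_trans (ltW (opp_rad_gt0 a k.+1)))// (itvP xr).
by apply: dL; rewrite ger0_norm// (le_lt_trans _ (rd k (leqnn k)))// (itvP xr).
Unshelve. all: by end_near. Qed.

End AlternatingMap.
End Axis.

(** * Values at multiples of pi, and passage to the limit map *)

Lemma cos_natpi (R : realType) (k : nat) : cos (k%:R * pi) = (-1) ^+ k :> R.
Proof.
have /(_ k 0) := alternatingn (@cosDpi R).
by rewrite add0r cos0 mulr1 mulr_natl.
Qed.

Lemma sin_natpi (R : realType) (k : nat) : sin (k%:R * pi) = 0 :> R.
Proof.
have /(_ k 0) := alternatingn (@sinDpi R).
by rewrite add0r sin0 mulr0 mulr_natl.
Qed.

Theorem lemma11p11 (R : realType) (n : nat) (hn : (0 < n)%N)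
  (a : R) (ha : 0 < a < 2)
  (rho : R -> R)
  (rho_smooth : smooth_on (`]0, 1] : set R) rho)
  (rho_ge0 : forall r, r \in `]0, 1] -> 0 <= rho r)
  (rho_near1 : \forall r \near 1^'-, rho r = 0)
  (rho_ext : forall r, 1 <= r -> rho r = 0)
  (rho_near0 : \forall r \near 0^'+, rho r = r `^ (- a))
  (eta : R -> R)
  (eta_smooth : smooth setT eta)
  (eta_range : forall z, 0 <= eta z <= 1)
  (eta_supp : compact (closure [set z | eta z != 0]))
  (eta_near0 : \forall z \near 0, eta z = 1)
  (rho_eta : exists2 u : R, 0 < u &
     forall z r, `|z| <= u -> 0 <= r ->
       eta (z + zshift rho r) = 1 /\ eta (z - zshift rho r) = 1)
  (eps : nat -> R)
  (eps_gt0 : forall j, 0 < eps j)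
  (eps_noninc : forall j k, (j <= k)%N -> eps k <= eps j)
  (eps_cvg0 : eps j @[j --> \oo] --> 0)
  (rhoj : nat -> R -> R)
  (rhoj_smooth : forall j, smooth_on (`[0, 1] : set R) (rhoj j))
  (rhoj_eq : forall j r, r \in `[0, 1] -> eps j <= r -> rhoj j r = rho r)
  (rhoj_ge0 : forall j r, r \in `[0, 1] -> 0 <= rhoj j r)
  (rhoj_mono : forall j k r, (j <= k)%N -> r \in `[0, 1] ->
     rhoj j r <= rhoj k r)
  (rhoj_le : forall j r, r \in `]0, 1] -> rhoj j r <= rho r)
  (H_smooth : forall j,
     smooth setT (Ham eta (rhoj j) : 'rV[R]_(n + n + 1) -> R))
  (phij : nat -> R -> 'rV[R]_(n + n + 1) -> 'rV[R]_(n + n + 1))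
  (phij_flow : forall j, contact_flow (Ham eta (rhoj j)) (phij j))
  (phi : R -> 'rV[R]_(n + n + 1) -> 'rV[R]_(n + n + 1))
  (phi_isotopy : compact_isotopy phi)
  (phij_cvg : {uniform `[0, 1] `*` setT,
     (fun j (q : R * 'rV[R]_(n + n + 1)) => phij j q.1 q.2) @ \oo -->
     (fun q : R * 'rV[R]_(n + n + 1) => phi q.1 q.2)}) :
  ~ eucl_lipschitz (phi 1) /\ ~ Ck_on setT 1 (phi 1).
Proof.
have /andP[a0 _] := ha; have [u u0 etaZ] := rho_eta.
pose i0 := Ordinal hn.
have rhoj1 j : eps j <= 1 -> rhoj j 1 = 0.
  by move=> e1; rewrite rhoj_eq ?rho_ext// in_itv/= ler01 lexx.
have crhoj j : {within `[0, 1], continuous (rhoj j)}.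
  exact: smooth_on_within_continuous.
(* At a radius where [rhoj j] already agrees with [rho], the approximating flow rotates by (k + 1)
   pi: the sine vanishes and the cosine is the sign. *)
have phij_axis j (r : R) k : 0 < r < 1 -> eps j <= r -> rho r = k.+1%:R * pi ->
    xc (phij j 1 (r *: xdir i0)) i0 = (-1) ^+ k.+1 * r.
  move=> /andP[r0 r1] er rhoE.
  have eq s : r <= s <= 1 -> rhoj j s = rho s.
    move=> /andP[rs s1]; apply: rhoj_eq; last exact: le_trans rs.
    by rewrite in_itv/= s1 andbT (le_trans (ltW r0)).
  have rE : Defs.rad (r *: xdir i0 : 'rV[R]_(n + n + 1)) = r by rewrite rad_axis// ltW.
  have eqr : rhoj j r = k.+1%:R * pi by rewrite eq ?lexx ?ltW.
  set p : 'rV[R]_(n + n + 1) := r *: xdir i0.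
  have eta1 t : 0 <= t <= 1 ->
      forall w, `|w - t * zshift_pos (rhoj j) (Defs.rad p)| <= u -> eta w = 1.
    (* The height at time [t] is the full shift at some [c >= r]. From [c] on [rhoj j] equals [rho],
       so the assumption on [eta] applies at radius [c], with [w - t * Z] as its small argument and
       the plus sign. *)
    rewrite rE => t01 w wu.
    have r01 : 0 <= r <= 1 by rewrite !ltW.
    have [|c /andP[rc c1] cE] := @zshift_pos_scaled R (rhoj j) (crhoj j) r t _ r01 t01.
      by apply: rhoj1; rewrite (le_trans er)// ltW.
    have c0 : 0 < c by exact: lt_le_trans rc.
    have [+ _] := etaZ _ c wu (ltW c0).
    rewrite /zshift c0 -(@eq_zshift_pos R rho (rhoj j))// => [|s /andP[cs s1]].
      by rewrite cE subrK.
    by apply: eq; rewrite s1 (le_trans rc).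
  have dF : is_derive (Defs.rad p) 1 (tail_int (rhoj j))
      (- (Defs.rad p * rhoj j (Defs.rad p))).
    by rewrite rE; apply: tail_int_is_derive => //; rewrite r0.
  have Hd q : differentiable (Ham eta (rhoj j) : 'rV[R]_(n + n + 1) -> R) q.
    exact: (H_smooth j 1%N).1 q I.
  have z0 : zc p = 0 by rewrite zcZ zc_xdir mulr0.
  have rp0 : 0 < Defs.rad p by rewrite rE.
  have := @trajectory_x R n eta (rhoj j) (phij j) p u Hd (phij_flow j) z0 rp0 dF u0 eta1 i0.
  rewrite rE eqr cos_natpi sin_natpi mulr0 subr0 [in RHS]xcZ xc_xdir eqxx mulr1 => <-.
  by rewrite mulrCA -expr2 sqrr_sign mulr1.
have phi_axis (r : R) k : 0 < r < 1 -> rho r = k.+1%:R * pi ->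
    xc (phi 1 (r *: xdir i0)) i0 = (-1) ^+ k.+1 * r.
  move=> r01 rhoE; set p : 'rV[R]_(n + n + 1) := r *: xdir i0.
  (* Uniform convergence, restricted to the single point [(1, p)]. *)
  have cv : phij j 1 p @[j --> \oo] --> phi 1 p.
    have sub : [set ((1 : R), p)] `<=` `[0, 1] `*` setT.
      by move=> _ ->; split => //=; rewrite in_itv/= ler01 lexx.
    have := uniform_subset_cvg _ sub phij_cvg.
    by rewrite uniform_set1; exact.
  have eps_small : \forall j \near \oo, eps j <= r.
    have /andP[r0 _] := r01.
    move/cvgrPdist_le : eps_cvg0 => /(_ _ r0); apply: filterS => j.
    by rewrite sub0r normrN; exact/le_trans/ler_norm.
  have cvx : xc (phij j 1 p) i0 @[j --> \oo] --> xc (phi 1 p) i0.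
    exact: (cvg_comp _ _ cv (@coord_continuous _ _ _ _ _ _)).
  (* For a fixed radius the sequence is constant as soon as [eps j <= r]. *)
  have cvc : xc (phij j 1 p) i0 @[j --> \oo] --> (-1) ^+ k.+1 * r.
    apply: cvg_near_cst; near=> j; apply: phij_axis => //.
    by near: j; exact: eps_small.
  exact: (cvg_unique _ cvx cvc).
have [d d0 rho_d] : exists2 d : R, 0 < d & forall r, 0 < r < d -> rho r = r `^ (- a).
  move: rho_near0 => /nbhs_ballP[d /= d0 rd]; exists d => // r /andP[r0 r_d].
  by apply: rd => //; rewrite /ball/= sub0r normrN gtr0_norm.
(* Below [d] the profile is the pure power; below 1 the radius lies in the range of [phi_axis]. *)
have [|K _ Kd] := opp_rad_small a a0 (Num.min d 1); first by rewrite lt_min d0 ltr01.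
have fK k : (K <= k)%N -> xc (phi 1 (opp_rad a k *: xdir i0)) i0 = (-1) ^+ k.+1 * opp_rad a k.
  move=> Kk; have := Kd K (leqnn K) k Kk; rewrite lt_min => /andP[rd r1].
  apply: phi_axis; rewrite ?opp_rad_gt0//.
  by rewrite rho_d ?opp_rad_gt0// opp_rad_powR.
split; first exact: (alternating_not_eucl_lipschitz _ a i0 K a0 fK).
exact: (alternating_not_C1 _ a i0 K a0 fK).
Unshelve. all: by end_near. Qed.
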